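(* Let $H$ be a Hilbert space. For every bounded sequence $(u_n)_{n \in \mathbb{N}}$ in $H$ the inequality $$\limsup_{N \to \infty} \left\|\frac{1}{N} \sum_{n=1}^N u_n\right\|^2 \leq \liminf_{J \to \infty} \frac{1}{J}\sum_{j=1}^J \limsup_{N \to \infty} \frac{1}{N}\sum_{n=1}^{N} \operatorname{Re}(u_n|u_{n+j})$$ holds.
   Context: $\mathbb{N} = \{1,2,3,\dots\}$. Hilbert spaces are complex, and $(\cdot|\cdot)$ denotes the inner product of $H$ (linear in the first argument). *)

(* Defs.v *)
From HB Require Import structures.
From mathcomp Require Export all_boot all_order all_algebra.
From mathcomp Require Export all_classical all_reals all_analysis.
From mathcomp Require Export complex.
Export Order.TTheory GRing.Theory Num.Theory numFieldNormedType.Exports.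

Set Implicit Arguments.
Unset Strict Implicit.
Unset Printing Implicit Defensive.

Local Open Scope ring_scope.

(* A complex Hilbert space is a complete normed module over [R[i]] together
   with an inner product, conjugate-linear in the second argument (see [dot]
   in sesquilinear.v), that induces the norm. *)
Definition induces_norm (R : realType) (H : normedModType R[i])
    (ip : {dot H for Num.conj}) : Prop :=
  forall x : H, `|x| ^+ 2 = ip x x.

(* [`|x|] is [R[i]]-valued in a normed module over [R[i]]. *)
Definition rnorm (R : realType) (H : normedModType R[i]) (x : H) : R :=
  complex.Re `|x|.

Lemma rnormE (R : realType) (H : normedModType R[i]) (x : H) :
  (rnorm x)%:C%C = `|x|.
Proof.
rewrite /rnorm; move: (normr_ge0 x); case: `|x| => a b.
by rewrite lecE /= => /andP[/eqP -> _].
Qed.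

(* Main.v *)
Require Import Defs.
From mathcomp Require Import ring lra.

Set Implicit Arguments.
Unset Strict Implicit.
Unset Printing Implicit Defensive.

Local Open Scope classical_set_scope.
Local Open Scope ring_scope.

(** Write [x_N] for the mean of [u_1, ..., u_N], [E_N] for averages over
    [1 <= n <= N], [g j] for the limsup in [N] of the lag-[j] correlation
    [E_N Re (u_n | u_(n+j))], and [A_J u (n)] for the forward average of
    [u_(n+1), ..., u_(n+J)].  Averaging the correlations over all pairs of lags
    in a window of length [J] yields Fejer means of [g], which are controlled by
    the limsup of the Cesaro means of [g] only.  The liminf is reached by
    combining several windows of very different lengths.

    Suppose the Cesaro means of [g] are at most [b] for infinitely many [J], and
    choose such lengths [J_1 << J_2 << ... << J_r].  When [J_i << J_k], a shift
    by at most [J_i] changes [A_(J_k) u] very little, so that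
    for large [N] the average [E_N Re (A_(J_i) u | A_(J_k) u)] is about
    [E_N Re (u | A_(J_k) u)], hence at most about [b].  With [|u_n| ^ 2 <= M],
    the sum [y] of the [A_(J_i) u] satisfies
      [E_N |y| ^ 2 <= r M + r (r - 1) b + o(1)],
    while [E_N y] is [r x_N + o(1)].  Since [0 <= E_N |y / r - x_N| ^ 2], this
    gives [|x_N| ^ 2 <= b + O(1 / r)] for all large [N].  Letting [r] grow and
    then [b] decrease to the liminf proves the inequality.

    The windows are chosen one at a time, in [exists_asymptotic_weight].  What
    this needs of the current sum [y] is recorded by [asymptotic_weight], which
    is stable under shifts, sums and scaling and therefore passes from [u] to
    its forward averages.  The conclusion for fixed [b] is
    [near_sqnorm_vmean_le].  No subsequence in [N] is ever extracted: every
    estimate holds for all large [N]. *)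

(** * Averages of real sequences *)

Definition mean (R : realType) (N : nat) (f : nat -> R) : R :=
  N%:R^-1 * \sum_(1 <= n < N.+1) f n.

Section RealMean.
Variable R : realType.
Implicit Types (f g : nat -> R) (N : nat) (c : R).

Lemma meanD N f g : mean N (fun n => f n + g n) = mean N f + mean N g.
Proof. by rewrite /mean big_split mulrDr. Qed.

Lemma meanZ N c f : mean N (fun n => c * f n) = c * mean N f.
Proof. by rewrite /mean -mulr_sumr mulrCA. Qed.

Lemma eq_mean N f g :
  (forall n, (1 <= n)%N -> f n = g n) -> mean N f = mean N g.
Proof.
move=> fg; rewrite /mean; congr (_ * _).
by apply: eq_big_nat => n /andP[n1 _]; exact: fg.
Qed.

Lemma le_mean N f g :
  (forall n, (1 <= n)%N -> f n <= g n) -> mean N f <= mean N g.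
Proof.
move=> fg; apply: ler_wpM2l; first by rewrite invr_ge0.
by rewrite !big_nat; apply: ler_sum => n /andP[n1 _]; exact: fg.
Qed.

Lemma mean_cst N c : (0 < N)%N -> mean N (fun=> c) = c.
Proof.
move=> N0; rewrite /mean sumr_const_nat subSS subn0 -[c *+ N]mulr_natl mulKf//.
by rewrite pnatr_eq0 -lt0n.
Qed.

Lemma mean_le_cst N f c :
  (0 < N)%N -> (forall n, (1 <= n)%N -> f n <= c) -> mean N f <= c.
Proof. by move=> N0 fc; rewrite -(mean_cst c N0); exact: le_mean. Qed.

Lemma mean_exchange N J (F : nat -> nat -> R) :
  mean N (fun n => mean J (F n)) = mean J (fun j => mean N (F^~ j)).
Proof.
rewrite /mean -!mulr_sumr mulrCA; congr (_ * (_ * _)).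
by rewrite exchange_big.
Qed.

Lemma mean_shift N f :
  mean N (fun n => f n.+1) = mean N f + N%:R^-1 * (f N.+1 - f 1%N).
Proof.
rewrite /mean -mulrDr; congr (_ * _).
by rewrite -(@telescope_sumr _ 1 N.+1)// -big_split; apply: eq_bigr => i _ /=; lra.
Qed.

(** Only finitely many lags are involved, so the estimates on each of them hold
    simultaneously. *)
Lemma near_mean_le J (F : nat -> nat -> R) (g : nat -> R) :
  (0 < J)%N ->
  (forall j, (1 <= j)%N -> forall e, 0 < e ->
    \forall N \near \oo, F N j <= g j + e) ->
  forall e, 0 < e -> \forall N \near \oo, mean J (F N) <= mean J g + e.
Proof.
move=> J0 Fg e e0.
have H : \forall N \near \oo, forall j : 'I_J, F N j.+1 <= g j.+1 + e.
  by apply: filter_forall => j; exact: Fg.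
apply: filterS H => N HN.
rewrite -[X in _ + X](mean_cst e J0) -meanD /mean.
apply: ler_wpM2l; first by rewrite invr_ge0.
rewrite !big_add1 !big_mkord/=; apply: ler_sum => j _; exact: HN.
Qed.

Lemma near_invn_le c : forall e, 0 < e -> \forall N \near \oo, N%:R^-1 * c <= e.
Proof.
move=> e e0; near=> N.
have N0 : 0 < N%:R :> R by near: N; exact: nbhs_infty_gtr.
rewrite ler_pdivrMl// -ler_pdivrMr//; apply: ltW.
by near: N; exact: nbhs_infty_gtr.
Unshelve. all: by end_near. Qed.

End RealMean.

(** * Limits superior and eventual bounds *)

Section LimnEsup.
Variable R : realType.
Implicit Type f : nat -> \bar R.

Lemma limn_esup_le_near f (a : \bar R) :
  (\forall N \near \oo, (f N <= a)%E) -> (limn_esup f <= a)%E.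
Proof.
move=> fa; apply: (@le_trans _ _ (ereal_sup [set f x | x in [set N | (f N <= a)%E]])).
  by apply: ereal_inf_lbound; exists [set N | (f N <= a)%E].
by apply: ge_ereal_sup => _ [N /= fN <-].
Qed.

Lemma limn_esup_lt_near f (a : \bar R) :
  (limn_esup f < a)%E -> \forall N \near \oo, (f N < a)%E.
Proof.
move=> /ereal_inf_lt[_ [V Voo <-] supV]; apply: filterS Voo => N VN.
by apply: le_lt_trans supV; apply: ereal_sup_ubound; exists N.
Qed.

Lemma limn_einf_lt_frequently f (a : \bar R) :
  (limn_einf f < a)%E -> forall P : set nat, (\forall J \near \oo, P J) ->
  exists2 J, P J & (f J < a)%E.
Proof.
move=> fa P Poo; apply: contrapT => nex.
move: fa; apply/negP; rewrite -leNgt /limn_einf leeNr.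
apply: limn_esup_le_near; apply: filterS Poo => J PJ /=.
by rewrite leeN2 leNgt; apply/negP => faJ; apply: nex; exists J.
Qed.

Lemma limn_esup_bounded f (M : R) :
  (\forall N \near \oo, ((- M)%:E <= f N <= M%:E)%E) -> limn_esup f \is a fin_num.
Proof.
move=> fM; rewrite fin_real//; apply/andP; split; last first.
  apply: (@le_lt_trans _ _ M%:E); last exact: ltry.
  by apply: limn_esup_le_near; apply: filterS fM => N /andP[].
apply: (@lt_le_trans _ _ (- M)%:E); first exact: ltNyr.
rewrite leNgt; apply/negP => /limn_esup_lt_near fltM.
have [N [/andP[+ _]]] := filter_ex (filterI fM fltM).
by rewrite /= leNgt => /negP.
Qed.

End LimnEsup.

(** * The real part of a complex inner product *)

Section RealInnerProduct.
Variables (R : realType) (H : completeNormedModType R[i]).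
Variable ip : {dot H for Num.conj}.
Implicit Types (x y z : H) (v : nat -> H).

(** Only real parts enter the inequality, and they form a symmetric bilinear form
    over the reals with the same squared norms. *)
Definition rip x y : R := complex.Re (ip x y).

Lemma ripC x y : rip x y = rip y x.
Proof.
have Re_conj (z : R[i]) : complex.Re (Num.conj z) = complex.Re z by case: z.
by rewrite /rip hermC expr0 mul1r Re_conj.
Qed.

Lemma ripDl x y z : rip (x + y) z = rip x z + rip y z.
Proof. by rewrite /rip linearDl raddfD. Qed.

Lemma ripDr x y z : rip x (y + z) = rip x y + rip x z.
Proof. by rewrite ripC ripDl !(ripC x). Qed.

Lemma ripNl x y : rip (- x) y = - rip x y.
Proof. by rewrite /rip linearNl raddfN. Qed.

Lemma ripNr x y : rip x (- y) = - rip x y.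
Proof. by rewrite ripC ripNl ripC. Qed.

Lemma rip0l x : rip 0 x = 0.
Proof. by rewrite /rip linear0l. Qed.

Lemma ripZl k x y : rip (k%:R^-1 *: x) y = k%:R^-1 * rip x y.
Proof.
rewrite /rip linearZl_LR /=.
have -> : k%:R^-1 = (k%:R^-1)%:C%C :> R[i] by rewrite fmorphV rmorph_nat.
by case: (ip x y) => a b /=; rewrite mul0r subr0.
Qed.

Lemma ripZr k x y : rip x (k%:R^-1 *: y) = k%:R^-1 * rip x y.
Proof. by rewrite ripC ripZl ripC. Qed.

Lemma rip_ge0 x : 0 <= rip x x.
Proof. by have := dnorm_ge0 ip x; rewrite /rip lecE => /andP[]. Qed.

Lemma rip_le_half x y : rip x y <= (rip x x + rip y y) / 2.
Proof.
have := rip_ge0 (x - y); rewrite ripDl !ripDr !ripNl !ripNr (ripC y x); lra.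
Qed.

Lemma rip_suml I (r : seq I) (F : I -> H) x :
  rip (\sum_(i <- r) F i) x = \sum_(i <- r) rip (F i) x.
Proof.
by apply: (big_morph (rip^~ x)) => [y z|]; [exact: ripDl|exact: rip0l].
Qed.

Definition vmean N v : H := N%:R^-1 *: \sum_(1 <= n < N.+1) v n.

Lemma rip_vmeanl N v x : rip (vmean N v) x = mean N (fun n => rip (v n) x).
Proof. by rewrite /vmean ripZl rip_suml. Qed.

Lemma rip_vmeanr N v x : rip x (vmean N v) = mean N (fun n => rip x (v n)).
Proof. by rewrite ripC rip_vmeanl; apply: eq_mean => n _; rewrite ripC. Qed.

Lemma vmean_shift N v :
  vmean N (fun n => v n.+1) = vmean N v + N%:R^-1 *: (v N.+1 - v 1%N).
Proof.
rewrite /vmean -scalerDr; congr (_ *: _).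
rewrite -(@telescope_sumr _ 1 N.+1)// -big_split; apply: eq_bigr => i _ /=.
by rewrite addrC subrK.
Qed.

(** Convexity of the squared norm: averaging
    [Re (v_n | x) <= (|v_n| ^ 2 + |x| ^ 2) / 2] at the mean [x] gives
    [|x| ^ 2 <= (K + |x| ^ 2) / 2]. *)
Lemma rip_vmean_le N v (K : R) :
  (0 < N)%N -> (forall n, (1 <= n)%N -> rip (v n) (v n) <= K) ->
  rip (vmean N v) (vmean N v) <= K.
Proof.
move=> N0 vK; set x := vmean N v.
suff : rip x x <= (K + rip x x) / 2 by lra.
rewrite {1}rip_vmeanl; apply: mean_le_cst => // n n1.
by apply: le_trans (rip_le_half _ _) _; have := vK n n1; lra.
Qed.

Lemma rnorm_sqr (ip_norm : induces_norm ip) x : rnorm x ^+ 2 = rip x x.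
Proof.
have /(congr1 (@complex.Re R)) := ip_norm x.
by rewrite -rnormE -rmorphXn.
Qed.

Lemma rip_bounded (ip_norm : induces_norm ip) (u : nat -> H) :
  [bounded u n | n in [set n | (1 <= n)%N]] ->
  exists M : R, forall n, (1 <= n)%N -> rip (u n) (u n) <= M.
Proof.
rewrite /bounded_near => /pinfty_ex_gt0[M _ uM].
exists (complex.Re M ^+ 2) => n n1; rewrite -rnorm_sqr//.
have u0 : 0 <= rnorm (u n).
  by have := normr_ge0 (u n); rewrite -rnormE lecE => /andP[].
have uMn : rnorm (u n) <= complex.Re M.
  by have /= := uM n n1; rewrite -rnormE lecE => /andP[].
by rewrite ler_sqr// nnegrE (le_trans u0).
Qed.

End RealInnerProduct.

(** * Combining windows of different lengths *)

Section VanDerCorput.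
Variables (R : realType) (H : completeNormedModType R[i]).
Variable ip : {dot H for Num.conj}.
Local Notation rip := (rip ip).
Variables (u : nat -> H) (M : R).
Hypothesis uM : forall n, (1 <= n)%N -> rip (u n) (u n) <= M.
Variables (g : nat -> R) (b : R).
Hypothesis ug : forall j, (1 <= j)%N -> forall e, 0 < e ->
  \forall N \near \oo, mean N (fun n => rip (u n) (u (n + j)%N)) <= g j + e.
Hypothesis gb : forall P : set nat, (\forall J \near \oo, P J) ->
  exists2 J, P J & mean J g <= b.

Definition forward_mean (J n : nat) : H := vmean J (fun j => u (n + j)%N).

(** The model case is [y_n] equal to the sum of the [c_a u_(n+a)] over finitely
    many [a], where [c] is the sum of the [c_a].  In the limit, such a [y] behaves
    like [c] copies of [u], both against forward averages of [u] over a long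
    window with small correlations and against the mean of [u].  How long the
    window must be depends on [y] and [e], and how large [N] must be depends on
    the window: this is what forces the windows to be chosen in succession. *)
Definition asymptotic_weight (y : nat -> H) (c : R) : Prop :=
  [/\ exists K : R, forall n, (1 <= n)%N -> rip (y n) (y n) <= K,
      forall e, 0 < e -> \forall J \near \oo, mean J g <= b ->
        \forall N \near \oo,
          mean N (fun n => rip (y n) (forward_mean J n)) <= c * b + e
    & forall e, 0 < e -> \forall N \near \oo,
        c * rip (vmean N u) (vmean N u)
          <= mean N (fun n => rip (y n) (vmean N u)) + e].

Lemma rip_forward_mean_le J n : (0 < J)%N -> (1 <= n)%N ->
  rip (forward_mean J n) (forward_mean J n) <= M.
Proof.
move=> J0 n1; apply: rip_vmean_le => // j j1; apply: uM.
by rewrite (leq_trans n1)// leq_addr.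
Qed.

Lemma asymptotic_weight0 : asymptotic_weight (fun=> 0) 0.
Proof.
have mean0 v N : mean N (fun n => rip 0 (v n)) = 0.
  by rewrite /mean big1 ?mulr0// => i _; rewrite rip0l.
split; first by exists 0 => n _; rewrite rip0l.
- move=> e e0; apply: nearW => J _; apply: nearW => N.
  by rewrite mul0r add0r mean0 ltW.
- move=> e e0; apply: nearW => N.
  by rewrite mul0r mean0 add0r ltW.
Qed.

Lemma asymptotic_weightD y y' c c' :
  asymptotic_weight y c -> asymptotic_weight y' c' ->
  asymptotic_weight (fun n => y n + y' n) (c + c').
Proof.
move=> [[K yK] yJ yx] [[K' yK'] yJ' yx']; split.
- exists (2 * K + 2 * K') => n n1; rewrite ripDl !ripDr (ripC _ (y' n) (y n)).
  have := rip_le_half ip (y n) (y' n); have := yK _ n1; have := yK' _ n1; lra.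
- move=> e e0; have e20 : 0 < e / 2 by lra.
  apply: filterS2 (yJ _ e20) (yJ' _ e20) => J HJ HJ' Jb.
  apply: filterS2 (HJ Jb) (HJ' Jb) => N HN HN'.
  under [X in X <= _]eq_mean do rewrite ripDl.
  rewrite meanD; lra.
- move=> e e0; have e20 : 0 < e / 2 by lra.
  apply: filterS2 (yx _ e20) (yx' _ e20) => N HN HN'.
  under [X in _ <= X + _]eq_mean do rewrite ripDl.
  rewrite meanD; lra.
Qed.

Lemma asymptotic_weightZ k y c : (0 < k)%N ->
  asymptotic_weight y c ->
  asymptotic_weight (fun n => k%:R^-1 *: y n) (k%:R^-1 * c).
Proof.
move=> k0 [[K yK] yJ yx].
have k0R : 0 < k%:R^-1 :> R by rewrite invr_gt0 ltr0n.
have kK : k%:R^-1 * k%:R = 1 :> R by rewrite mulVf// pnatr_eq0 -lt0n.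
split.
- exists (k%:R^-1 * (k%:R^-1 * K)) => n n1; rewrite ripZl ripZr.
  by rewrite !ler_pM2l//; exact: yK.
- move=> e e0; have ek0 : 0 < k%:R * e by rewrite mulr_gt0// ltr0n.
  apply: filterS (yJ _ ek0) => J HJ Jb.
  apply: filterS (HJ Jb) => N HN.
  under [X in X <= _]eq_mean do rewrite ripZl.
  have := ler_wpM2l (ltW k0R) HN; rewrite mulrDr (mulrA _ k%:R) kK mul1r meanZ.
  by rewrite -(mulrA _ c).
- move=> e e0; have ek0 : 0 < k%:R * e by rewrite mulr_gt0// ltr0n.
  apply: filterS (yx _ ek0) => N HN.
  under [X in _ <= X + _]eq_mean do rewrite ripZl.
  have := ler_wpM2l (ltW k0R) HN; rewrite mulrDr (mulrA _ k%:R) kK mul1r meanZ.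
  by rewrite -(mulrA _ c).
Qed.

Lemma asymptotic_weight_id : asymptotic_weight u 1.
Proof.
split; first by exists M.
- move=> e e0; near=> J => Jb.
  have J0 : (0 < J)%N by near: J; exact: nbhs_infty_gt.
  apply: filterS (near_mean_le J0 ug e0) => N.
  under [X in _ -> X <= _]eq_mean do rewrite /forward_mean rip_vmeanr.
  rewrite mean_exchange; lra.
- move=> e e0; apply: nearW => N.
  by rewrite mul1r -rip_vmeanl lerDl ltW.
Unshelve. all: by end_near. Qed.

(** Two telescoping errors occur.  Replacing [A_J u (n)] by [A_J u (n+1)] costs
    the two extreme terms of the window, of relative size [1 / J]; shifting the
    average in [n] afterwards costs two boundary terms divided by [N]. *)
Lemma asymptotic_weight_shift y c :
  asymptotic_weight y c -> asymptotic_weight (fun n => y n.+1) c.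
Proof.
move=> [[K yK] yJ yx].
have yz_le m n z z' : (1 <= m)%N -> (1 <= n)%N -> rip z z <= M ->
    rip z' z' <= M -> rip (y m) z - rip (y n) z' <= K + M.
  move=> m1 n1 zM zM'; have := rip_le_half ip (y m) z.
  have := rip_le_half ip (y n) (- z'); rewrite !ripNr ripNl opprK.
  by have := yK m m1; have := yK n n1; lra.
split; first by exists K => n _; exact: yK.
- move=> e e0; have e30 : 0 < e / 3 by lra.
  near=> J => Jb.
  have J0 : (0 < J)%N by near: J; exact: nbhs_infty_gt.
  have Jsmall : J%:R^-1 * (K + M) <= e / 3.
    by near: J; exact: near_invn_le.
  have H1 : \forall N \near \oo,
      mean N (fun n => rip (y n) (forward_mean J n)) <= c * b + e / 3.
    by move: Jb; near: J; exact: yJ.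
  have forward_meanS n : forward_mean J n =
      forward_mean J n.+1 + J%:R^-1 *: (u n.+1 - u (n + J.+1)%N).
    have -> : forward_mean J n.+1 = vmean J (fun j => u (n + j.+1)%N).
      by rewrite /forward_mean /vmean; under eq_bigr do rewrite addSnnS.
    rewrite (vmean_shift J (fun j => u (n + j)%N)) -addrA -scalerDr addn1.
    by rewrite addrA subrK subrr scaler0 addr0.
  apply: filterS3 H1 (near_invn_le (K + M) e30) (nbhs_infty_gt 0) => N HN Nsmall N0.
  pose lag n := rip (y n.+1) (u n.+1) - rip (y n.+1) (u (n + J.+1)%N).
  have -> : mean N (fun n => rip (y n.+1) (forward_mean J n)) =
      mean N (fun n => rip (y n.+1) (forward_mean J n.+1)) + J%:R^-1 * mean N lag.
    rewrite -meanZ -meanD; apply: eq_mean => n n1.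
    by rewrite forward_meanS ripDr ripZr ripDr ripNr.
  rewrite (mean_shift N (fun n => rip (y n) (forward_mean J n))).
  have lag_le : mean N lag <= K + M.
    apply: mean_le_cst => // n n1; apply: yz_le => //; apply: uM => //.
    by rewrite (leq_trans n1)// leq_addr.
  have end_le : rip (y N.+1) (forward_mean J N.+1)
      - rip (y 1%N) (forward_mean J 1) <= K + M.
    by apply: yz_le => //; apply: rip_forward_mean_le.
  have := ler_wpM2l _ lag_le; have := ler_wpM2l _ end_le.
  move=> /(_ N%:R^-1) + /(_ J%:R^-1); rewrite !invr_ge0 !ler0n => /(_ isT) + /(_ isT).
  lra.
- move=> e e0; have e20 : 0 < e / 2 by lra.
  apply: filterS3 (yx _ e20) (near_invn_le (K + M) e20) (nbhs_infty_gt 0) => N.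
  move=> HN Nsmall N0; set x := vmean N u in HN *.
  have xM : rip x x <= M by exact: rip_vmean_le.
  rewrite (mean_shift N (fun n => rip (y n) x)).
  have end_le : rip (y 1%N) x - rip (y N.+1) x <= K + M by exact: yz_le.
  have := ler_wpM2l _ end_le; move=> /(_ N%:R^-1); rewrite invr_ge0 ler0n => /(_ isT).
  lra.
Unshelve. all: by end_near. Qed.

Lemma asymptotic_weight_shiftn j : asymptotic_weight (fun n => u (n + j)%N) 1.
Proof.
elim: j => [|j IH].
  by under eq_fun do rewrite addn0; exact: asymptotic_weight_id.
by under eq_fun do rewrite addnS -addSn; exact: asymptotic_weight_shift IH.
Qed.

Lemma asymptotic_weight_forward_mean J : (0 < J)%N ->
  asymptotic_weight (forward_mean J) 1.
Proof.
move=> J0; have JJ : J%:R^-1 * J%:R = 1 :> R by rewrite mulVf// pnatr_eq0 -lt0n.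
rewrite -JJ; apply: asymptotic_weightZ => //; elim: (J) => [|k IH].
  by under eq_fun do rewrite big_geq//; exact: asymptotic_weight0.
under eq_fun do rewrite big_nat_recr//=.
by rewrite -natr1; exact: asymptotic_weightD IH (asymptotic_weight_shiftn _).
Qed.

(** Adding the forward average [A_J u] of a long window with small correlations
    to [y] increases [E_N |y| ^ 2] by at most [2 (r b + 1 / 2) + M], whereas
    [r ^ 2 b] increases by [(2 r + 1) b]: the excess per step is
    [1 + M - b]. *)
Lemma exists_asymptotic_weight (r : nat) : exists2 y,
  asymptotic_weight y r%:R &
  \forall N \near \oo, mean N (fun n => rip (y n) (y n))
    <= r%:R ^+ 2 * b + r%:R * (1 + M - b).
Proof.
elim: r => [|r [y ycr yr]].
  exists (fun=> 0); first exact: asymptotic_weight0.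
  apply: nearW => N; rewrite /mean big1 ?mulr0 ?expr0n ?mul0r ?addr0// => i _.
  by rewrite rip0l.
have [_ yJ _] := ycr.
(* The error 1/2 may be kept fixed: over r steps it adds up to at most r, which
   is negligible compared with the square of r. *)
have half0 : 0 < 2^-1 :> R by rewrite invr_gt0.
have [J [J0 HJ] Jb] := gb (filterI (nbhs_infty_gt 0) (yJ _ half0)).
exists (fun n => y n + forward_mean J n).
  by rewrite -natr1; exact: asymptotic_weightD ycr (asymptotic_weight_forward_mean J0).
apply: filterS3 yr (HJ Jb) (nbhs_infty_gt 0) => N yN yJN N0.
have fmN : mean N (fun n => rip (forward_mean J n) (forward_mean J n)) <= M.
  by apply: mean_le_cst => // n n1; exact: rip_forward_mean_le.
have -> : mean N (fun n => rip (y n + forward_mean J n) (y n + forward_mean J n)) =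
    mean N (fun n => rip (y n) (y n))
    + 2 * mean N (fun n => rip (y n) (forward_mean J n))
    + mean N (fun n => rip (forward_mean J n) (forward_mean J n)).
  rewrite -meanZ -!meanD; apply: eq_mean => n _.
  rewrite ripDl !ripDr (ripC _ (forward_mean J n) (y n)); lra.
by rewrite -natr1; nra.
Qed.

(** For [y] as in [exists_asymptotic_weight], expanding [0 <= E_N |y / r - x_N| ^ 2] gives
    [|x_N| ^ 2 <= b + (3 + M - b) / r]; the correlations with [x_N] contribute
    [2 / r] and the norm of [y] the rest. *)
Lemma near_sqnorm_vmean_le e : 0 < e ->
  \forall N \near \oo, rip (vmean N u) (vmean N u) <= b + e.
Proof.
move=> e0; near \oo => r.
have r0 : 0 < r%:R :> R by near: r; exact: nbhs_infty_gtr.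
have rsmall : r%:R^-1 * (3 + M - b) <= e by near: r; exact: near_invn_le.
have [y [_ _ yx] yr] := exists_asymptotic_weight r.
apply: filterS3 (yx _ ltr01) yr (nbhs_infty_gt 0) => N; move: (vmean N u) => x xN yN N0.
have : 0 <= mean N (fun n => rip (r%:R^-1 *: y n - x) (r%:R^-1 *: y n - x)).
  by rewrite -[X in X <= _](mean_cst 0 N0); apply: le_mean => n _; exact: rip_ge0.
set q := rip x x in xN *.
have -> : mean N (fun n => rip (r%:R^-1 *: y n - x) (r%:R^-1 *: y n - x)) =
    r%:R^-1 * (r%:R^-1 * mean N (fun n => rip (y n) (y n)))
    + (- 2 * r%:R^-1 * mean N (fun n => rip (y n) x) + q).
  rewrite -[q in RHS](mean_cst q N0) -!meanZ -!meanD; apply: eq_mean => n _.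
  rewrite ripDl !ripDr !ripNl !ripNr opprK !ripZl !ripZr (ripC _ x) /q; lra.
have rr : r%:R^-1 * r%:R = 1 :> R by rewrite mulVf// gt_eqF.
have ri0 : 0 <= r%:R^-1 :> R by rewrite invr_ge0 ltW.
have := ler_wpM2l ri0 (ler_wpM2l ri0 yN); have := ler_wpM2l ri0 xN.
set Y := mean N _; set X := mean N _.
have -> : r%:R^-1 * (r%:R^-1 * (r%:R ^+ 2 * b + r%:R * (1 + M - b))) =
  b + r%:R^-1 * (1 + M - b) by field; rewrite gt_eqF.
have -> : r%:R^-1 * (r%:R * q) = q by rewrite mulrA rr mul1r.
lra.
Unshelve. all: by end_near. Qed.

End VanDerCorput.

Theorem theorem2p2 (R : realType) (H : completeNormedModType R[i])
  (ip : {dot H for Num.conj}) (ip_norm : induces_norm ip)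
  (u : nat -> H) (u_bounded : [bounded u n | n in [set n | (1 <= n)%N]]) :
  (limn_esup (fun N : nat =>
     (rnorm (N%:R^-1 *: \sum_(1 <= n < N.+1) u n) ^+ 2)%:E)
   <=
   limn_einf (fun J : nat =>
     (J%:R^-1)%:E * \sum_(1 <= j < J.+1)
       limn_esup (fun N : nat =>
         (N%:R^-1 * \sum_(1 <= n < N.+1) complex.Re (ip (u n) (u (n + j)%N)))%:E)))%E.
Proof.
have [M uM] := rip_bounded ip_norm u_bounded.
pose corr j N := mean N (fun n => rip ip (u n) (u (n + j)%N)).
pose g j : R := fine (limn_esup (fun N => (corr j N)%:E)).
have uM_shift n j : (1 <= n)%N -> rip ip (u (n + j)%N) (u (n + j)%N) <= M.
  by move=> n1; apply: uM; rewrite (leq_trans n1)// leq_addr.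
have corr_le j N : (0 < N)%N -> - M <= corr j N <= M.
  move=> N0; apply/andP; split.
    rewrite lerNl -mulN1r -meanZ; apply: mean_le_cst => // n n1.
    have := rip_le_half ip (- u n) (u (n + j)%N).
    rewrite !ripNl ripNr; have := uM n n1; have := uM_shift n j n1; lra.
  apply: mean_le_cst => // n n1; apply: le_trans (rip_le_half _ _ _) _.
  have := uM n n1; have := uM_shift n j n1; lra.
have gE j : limn_esup (fun N => (corr j N)%:E) = (g j)%:E.
  rewrite fineK//; apply: (@limn_esup_bounded _ _ M).
  by apply: filterS (nbhs_infty_gt 0) => N N0; rewrite !lee_fin corr_le.
have ug j : (1 <= j)%N -> forall e, 0 < e ->
    \forall N \near \oo, corr j N <= g j + e.
  move=> _ e e0; have : (limn_esup (fun N => (corr j N)%:E) < (g j + e)%:E)%E.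
    by rewrite gE lte_fin ltrDl.
  by move=> /limn_esup_lt_near; apply: filterS => N; rewrite lte_fin => /ltW.
have meangE J : ((J%:R^-1)%:E * \sum_(1 <= j < J.+1)
    limn_esup (fun N => (corr j N)%:E) = (mean J g)%:E)%E.
  by under eq_bigr do rewrite gE; rewrite sumEFin -EFinM.
rewrite [leRHS](_ : _ = limn_einf (fun J => (mean J g)%:E)); last first.
  by congr limn_einf; apply/funext => J; exact: meangE.
have le_b b : (limn_einf (fun J => (mean J g)%:E) < b%:E)%E ->
    (limn_esup (fun N => (rnorm (vmean N u) ^+ 2)%:E) <= b%:E)%E.
  move=> gb; apply/lee_addgt0Pr => e e0; apply: limn_esup_le_near.
  have gb' P : (\forall J \near \oo, P J) -> exists2 J, P J & mean J g <= b.
    move=> /(limn_einf_lt_frequently gb)[J PJ].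
    by rewrite lte_fin => /ltW; exists J.
  apply: filterS (near_sqnorm_vmean_le uM ug gb' e0) => N.
  by rewrite -EFinD lee_fin (rnorm_sqr ip_norm).
move: le_b; case: (limn_einf _) => [a| |] le_b.
- by apply/lee_addgt0Pr => e e0; rewrite -EFinD; apply: le_b; rewrite lte_fin ltrDl.
- exact: leey.
(* The liminf cannot be -oo, since the limsup on the left is nonnegative. *)
- have := le_b (-1) (ltNyr _); rewrite leNgt => /negP[].
  apply: (@lt_le_trans _ _ 0%E); first by rewrite lte_fin ltrN10.
  rewrite leNgt; apply/negP => /limn_esup_lt_near /filter_ex[N].
  by rewrite lte_fin ltNge sqr_ge0.
Qed.
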